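(* Let $A=[a_1\ \cdots\ a_n]\in\mathbb{R}^{m\times n}$ be a nonzero matrix, let $Q\in\mathbb{R}^{m\times m}$ be symmetric positive definite, let $b\in\mathbb{R}^m$, and let $f(y)=\frac12\langle y,Qy\rangle+\langle b,y\rangle$. Assume $x^*\in\Delta_{n-1}$ is a minimizer of $\min_{x\in\Delta_{n-1}}f(Ax)$. Let $y^*=Ax^*$ and $\bar A=Q^{1/2}[a_1-y^*\ \cdots\ a_n-y^*]$. If $x_0\in\Delta_{n-1}$ is one of the extreme points of $\Delta_{n-1}$, then the iterates $x_k\in\Delta_{n-1}$, $y_k=Ax_k$, $k=1,2,\dots$, generated by the Frank-Wolfe Algorithm with Away Steps (described in the context) started at $x_0$ satisfy $$f(y_k)-f(y^* )\le\left(1-\frac{\phi(\bar A)^2}{4\,d(\bar A)^2}\right)^{k/2}\bigl(f(y_0)-f(y^* )\bigr).$$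
   Context: $\|\cdot\|$ is the Euclidean norm and $\langle\cdot,\cdot\rangle$ the standard inner product. $\Delta_{n-1}=\{x\in\mathbb{R}^n: x\ge 0,\ \|x\|_1=1\}$; its extreme points are the standard basis vectors $e_1,\dots,e_n$. For $x\in\mathbb{R}^n$ with $x\ge0$ (componentwise), the support is $S(x)=\{i: x_i>0\}$. For a matrix $M\in\mathbb{R}^{m\times n}$ and $x\ge0$ with $Mx\ne0$ let $$\phi(M,x)=\sup\left\{\lambda>0:\ \exists\,u,v\in\Delta_{n-1},\ S(u)\subseteq S(x),\ Mu-Mv=\frac{\lambda}{\|Mx\|}Mx\right\}.$$ The restricted width and diameter are $$\phi(M)=\min\{\phi(M,x): x\ge0,\ Mx\ne0\},\qquad d(M)=\max_{x,u\in\Delta_{n-1}}\|Mx-Mu\|.$$ Frank-Wolfe Algorithm with Away Steps. Start with $x_0\in\Delta_{n-1}$, $y_0=Ax_0$. For $k=0,1,2,\dots$: - Let $j=\operatorname{argmin}_{i=1,\dots,n}\langle a_i,\nabla f(y_k)\rangle$ and $\ell=\operatorname{argmax}_{i\in S(x_k)}\langle a_i,\nabla f(y_k)\rangle$. - If $\langle a_j-y_k,\nabla f(y_k)\rangle<\langle y_k-a_\ell,\nabla f(y_k)\rangle$ (regular step), set $a=a_j-y_k$, $u=e_j-x_k$, $\theta_{\max}=1$. Otherwise (away step), set $a=y_k-a_\ell$, $u=x_k-e_\ell$, $\theta_{\max}=\frac{(x_k)_\ell}{1-(x_k)_\ell}$. - Let $\theta_k=\operatorname{argmin}_{\theta\in[0,\theta_{\max}]}f(y_k+\theta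 a)$, and set $x_{k+1}=x_k+\theta_k u$, $y_{k+1}=Ax_{k+1}$. *)

(* Defs.v *)
From HB Require Import structures.
From mathcomp Require Import all_boot all_order all_algebra.
From mathcomp Require Import all_classical all_reals all_analysis.

Set Implicit Arguments.
Unset Strict Implicit.
Unset Printing Implicit Defensive.

Import Order.TTheory GRing.Theory Num.Theory.
Import numFieldNormedType.Exports.

Local Open Scope classical_set_scope.
Local Open Scope ring_scope.

(** Vectors of R^n are columns ['cV[R]_n].  The norm [`|x|] that the library puts
    on matrices is the sup norm, hence the separate Euclidean [enorm]. *)

Section Euclidean.
Context {R : realType}.

Definition dot m (u v : 'cV[R]_m) : R := \sum_i u i 0 * v i 0.

Definition enorm m (u : 'cV[R]_m) : R := Num.sqrt (dot u u).

Definition norm1 m (u : 'cV[R]_m) : R := \sum_i `|u i 0|.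

Definition grad m (f : 'cV[R]_m -> R) (y : 'cV[R]_m) : 'cV[R]_m :=
  \col_i 'D_(delta_mx i 0) f y.

Definition posdefmx m (Q : 'M[R]_m) : Prop :=
  Q^T = Q /\ forall v : 'cV[R]_m, v != 0 -> 0 < dot v (Q *m v).

Definition possemidefmx m (Q : 'M[R]_m) : Prop :=
  Q^T = Q /\ forall v : 'cV[R]_m, 0 <= dot v (Q *m v).

(** A symmetric positive semidefinite [Q] has exactly one symmetric positive
    semidefinite square root, so the choice made by [get] is forced. *)
Definition sqrtmx m (Q : 'M[R]_m) : 'M[R]_m :=
  get [set P : 'M[R]_m | possemidefmx P /\ P *m P = Q].

Definition quadratic m (Q : 'M[R]_m) (b y : 'cV[R]_m) : R :=
  2^-1 * dot y (Q *m y) + dot b y.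

End Euclidean.

Section Argmin.
Context {R : realType} {T : Type}.

(** As relations: minimizers and maximizers need not be unique. *)
Definition is_argmin (C : set T) (g : T -> R) (t : T) : Prop :=
  C t /\ forall s, C s -> g t <= g s.

Definition is_argmax (C : set T) (g : T -> R) (t : T) : Prop :=
  C t /\ forall s, C s -> g s <= g t.

End Argmin.

Section Simplex.
Context {R : realType}.

Definition nonneg n (x : 'cV[R]_n) : Prop := forall i, 0 <= x i 0.

(** The simplex [Delta_{n-1}] of R^n. *)
Definition simplex n : set 'cV[R]_n := [set x | nonneg x /\ norm1 x = 1].

Definition supp n (x : 'cV[R]_n) : {set 'I_n} := [set i | 0 < x i 0]%SET.

Definition extreme_point n (C : set 'cV[R]_n) (p : 'cV[R]_n) : Prop :=
  C p /\ forall u v t, C u -> C v -> 0 < t < 1 ->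
    p = t *: u + (1 - t) *: v -> u = p /\ v = p.

End Simplex.

Section Width.
Context {R : realType} (m n : nat) (M : 'M[R]_(m, n)).

(** The set is bounded above (by [diam]); when it is empty, [sup] is 0. *)
Definition rwidth_at (x : 'cV[R]_n) : R :=
  sup [set lam : R | 0 < lam /\ exists u v : 'cV[R]_n,
    [/\ simplex u, simplex v, supp u \subset supp x
      & M *m u - M *m v = (lam / enorm (M *m x)) *: (M *m x)]].

(** The restricted width [phi(M)], a minimum over a nonempty set unless [M = 0];
    in that degenerate case [inf] is 0. *)
Definition rwidth : R :=
  inf [set r : R | exists x : 'cV[R]_n,
    [/\ nonneg x, M *m x != 0 & r = rwidth_at x]].

Definition diam : R :=
  sup [set r : R | exists x u : 'cV[R]_n,
    [/\ simplex x, simplex u & r = enorm (M *m x - M *m u)]].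

End Width.

Section FrankWolfeAway.
Context {R : realType} (m n : nat) (f : 'cV[R]_m -> R) (A : 'M[R]_(m, n)).

(** One iteration, from [(x, y)] to [(x', y')], for some choice [j], [l], [t] of
    the three (possibly non-unique) optimizers.  If [x l 0 = 1] then [x = e_l],
    and an away step has [u = 0] and [a = 0], so [(x', y') = (x, y)] whatever the
    step size: it is harmless that the bound [1 / 0] is 0 rather than infinite. *)
Definition afw_step (x : 'cV[R]_n) (y : 'cV[R]_m)
    (x' : 'cV[R]_n) (y' : 'cV[R]_m) : Prop :=
  let g := grad f y in
  exists (j l : 'I_n) (t : R),
    let regular := dot (col j A - y) g < dot (y - col l A) g in
    let a := if regular then col j A - y else y - col l A in
    let u := if regular then delta_mx j 0 - x else x - delta_mx l 0 in
    let tmax := if regular then 1 else x l 0 / (1 - x l 0) in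
    [/\ is_argmin [set: 'I_n] (fun i => dot (col i A) g) j,
        is_argmax [set i | i \in supp x] (fun i => dot (col i A) g) l,
        is_argmin `[0, tmax] (fun s => f (y + s *: a)) t,
        x' = x + t *: u
      & y' = A *m x'].

Definition afw_iterates (x : nat -> 'cV[R]_n) (y : nat -> 'cV[R]_m) : Prop :=
  [/\ simplex (x 0%N), y 0%N = A *m x 0%N
    & forall k, afw_step (x k) (y k) (x k.+1) (y k.+1)].

End FrankWolfeAway.

(* Main.v *)
(** Write [h k = f (y k) - f ystar] and [z k = Abar *m x k = sqrtmx Q *m (y k - ystar)].
    For a quadratic, [dot (y - ystar) (grad f y) = h + enorm z ^+ 2 / 2], which is
    at least [enorm z * Num.sqrt (2 * h)] by AM-GM.  Hence the restricted width bounds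
    the gap [G] between the away and the Frank-Wolfe vertex by
    [G >= rwidth Abar * Num.sqrt (2 * h)].  The better of the two directions has
    slope at most [- G / 2] and curvature at most [diam Abar ^+ 2], so a step that is
    not cut short by the bound on its size multiplies [h] by at most
    [r = 1 - rwidth Abar ^+ 2 / (4 * diam Abar ^+ 2)]; so does a regular step of
    size 1.  An away step of maximal size may gain nothing, but it removes a
    vertex from the support, and only regular steps add vertices, one at a time.
    Starting from a single vertex, at least half of the steps are therefore good. *)
Require Import Defs.
From mathcomp Require Import all_boot all_order all_algebra.
From mathcomp Require Import spectral complex.
From mathcomp Require Import all_classical all_reals all_analysis.
From mathcomp Require Import zify ring lra.

Set Implicit Arguments.
Unset Strict Implicit.
Unset Printing Implicit Defensive.

Import Order.TTheory GRing.Theory Num.Theory.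
Import numFieldNormedType.Exports.

Local Open Scope classical_set_scope.
Local Open Scope ring_scope.

(** * Roots of symmetric matrices by spectral calculus *)

Lemma interpolation_exists (F : fieldType) (g : F -> F) (s : seq F) :
  exists p : {poly F}, forall a, a \in s -> p.[a] = g a.
Proof.
elim: s => [|a s [p ps]]; first by exists 0.
have [sa|sNa] := boolP (a \in s).
  by exists p => c; rewrite inE => /predU1P[->|]; exact: ps.
pose q := \prod_(c <- s) ('X - c%:P).
have qa : q.[a] != 0 by rewrite -[_ == 0]/(root q a) root_prod_XsubC.
exists (p + ((g a - p.[a]) / q.[a]) *: q) => c; rewrite !hornerE inE.
have [->|_ /= sc] := eqVneq c a; first by move=> _; rewrite divfK ?subrKC.
have /rootP-> : root q c by rewrite root_prod_XsubC.
by rewrite mulr0 addr0 ps.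
Qed.

(* Interpolating fourth rather than square roots makes the square root
   [p(Q) ^+ 2] of [Q] positive semidefinite for free. *)
Lemma symmetric_fourth_root (R : rcfType) n (Q : 'M[R]_n.+1) :
  Q^T = Q -> (forall r, eigenvalue Q r -> 0 <= r) ->
  exists p : {poly R}, horner_mx Q p ^+ 4 = Q.
Proof.
(* [Q] is diagonalized over the complex numbers; since [p] is real, the identity descends to [Q] by
   injectivity of the embedding. *)
move=> Qsym Qge0; pose toC := @real_complex_def R (Phant R).
pose QC := map_mx toC Q.
have QCherm : QC \is hermsymmx.
  apply: realsym_hermsym.
    by apply/is_hermitianmxP; rewrite scale1r map_mx_id // /QC map_trmx Qsym.
  by apply/mxOverP => i j; rewrite mxE complex_real.
have QCE := orthomx_spectralP (hermitian_normalmx QCherm).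
have dreal := hermitian_spectral_diag_real QCherm.
set U := spectralmx QC in QCE; set d := spectral_diag QC in QCE dreal.
have Uu : U \is a GRing.unit by exact: spectral_unit.
have dE i : d 0 i = toC (complex.Re (d 0 i)).
  by rewrite [RHS]RRe_real // (mxOverP dreal).
have dge0 i : 0 <= complex.Re (d 0 i).
  apply: Qge0; rewrite eigenvalue_root_char -(fmorph_root toC) map_char_poly /=.
  rewrite -/QC -eigenvalue_root_char.
  rewrite -[X in eigenvalue _ X]/(toC _) -dE; apply/eigenvalueP.
  exists (row i U).
    rewrite QCE !mulmxA -row_mul mulmxV // row1 -rowE row_diag_mx.
    by rewrite -scalemxAl -rowE.
  apply/negP => /eqP Ui0; have := mulmxV Uu => /(congr1 (row i)).
  rewrite row_mul Ui0 mul0mx => /rowP/(_ i); rewrite !mxE eqxx => /eqP.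
  by rewrite eq_sym oner_eq0.
have [p pE] := interpolation_exists (fun r => Num.sqrt (Num.sqrt r))
  [seq complex.Re (d 0 i) | i <- enum 'I_n.+1].
exists p; apply: (@map_mx_inj _ _ toC).
rewrite -rmorphXn /= map_horner_mx -/QC [in LHS]QCE horner_mx_uconjC //.
rewrite [in RHS]QCE; congr (_ *m _ *m _).
rewrite horner_mx_diag; congr diag_mx; apply/rowP => i; rewrite mxE.
rewrite rmorphXn /= horner_exp dE horner_map /= -rmorphXn /= pE; last first.
  by apply: map_f; rewrite mem_enum.
by rewrite (exprM _ 2 2) !sqr_sqrtr ?sqrtr_ge0.
Qed.

(** * Inner product and Euclidean norm *)

Section Dot.
Context {R : realType} {m : nat}.
Implicit Types u v w : 'cV[R]_m.

Lemma dotC u v : dot u v = dot v u.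
Proof. by apply: eq_bigr => i _; rewrite mulrC. Qed.

Lemma dotDl u v w : dot (u + v) w = dot u w + dot v w.
Proof. by rewrite -big_split; apply: eq_bigr => i _; rewrite !mxE mulrDl. Qed.

Lemma dotZl a u v : dot (a *: u) v = a * dot u v.
Proof. by rewrite mulr_sumr; apply: eq_bigr => i _; rewrite !mxE mulrA. Qed.

Lemma dotNl u v : dot (- u) v = - dot u v.
Proof. by rewrite -scaleN1r dotZl mulN1r. Qed.

Lemma dotBl u v w : dot (u - v) w = dot u w - dot v w.
Proof. by rewrite dotDl dotNl. Qed.

Lemma dotDr u v w : dot u (v + w) = dot u v + dot u w.
Proof. by rewrite dotC dotDl !(dotC u). Qed.

Lemma dotZr a u v : dot u (a *: v) = a * dot u v.
Proof. by rewrite dotC dotZl dotC. Qed.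

Lemma dot_ge0 u : 0 <= dot u u.
Proof. by apply: sumr_ge0 => i _; rewrite -expr2 sqr_ge0. Qed.

Lemma enorm_sqr u : enorm u ^+ 2 = dot u u.
Proof. by rewrite sqr_sqrtr ?dot_ge0. Qed.

Lemma enorm_ge0 u : 0 <= enorm u.
Proof. exact: sqrtr_ge0. Qed.

Lemma enorm0_eq0 u : enorm u = 0 -> u = 0.
Proof.
move=> u0; have /eqP : dot u u = 0 by rewrite -enorm_sqr u0 expr0n.
rewrite psumr_eq0 => [/allP uu|i _]; last by rewrite -expr2 sqr_ge0.
apply/colP => i; rewrite mxE; apply/eqP.
by have := uu i (mem_index_enum i); rewrite /= mulf_eq0 orbb.
Qed.

Lemma enormZ a u : enorm (a *: u) = `|a| * enorm u.
Proof.
rewrite /enorm dotZl dotZr mulrA -expr2 sqrtrM ?sqr_ge0 //.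
by rewrite sqrtr_sqr.
Qed.

Lemma dot_delta i u : dot (delta_mx i 0) u = u i 0.
Proof.
rewrite /dot (bigD1 i) //= !mxE !eqxx mul1r big1 ?addr0 // => k /negbTE ki.
by rewrite !mxE ki mul0r.
Qed.

End Dot.

Lemma dot_mulmxr (R : realType) (m n : nat) (M : 'M[R]_(m, n)) u v :
  dot u (M *m v) = dot (M^T *m u) v.
Proof.
have dotE k (c d : 'cV[R]_k) : dot c d = (c^T *m d) 0 0.
  by rewrite mxE; apply: eq_bigr => i _; rewrite mxE.
by rewrite !dotE trmx_mul trmxK mulmxA.
Qed.

Lemma dot_mulmxl (R : realType) (m n : nat) (M : 'M[R]_(m, n)) x g :
  dot (M *m x) g = \sum_i x i 0 * dot (col i M) g.
Proof.
rewrite dotC dot_mulmxr dotC; apply: eq_bigr => i _; congr (_ * _).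
by rewrite mxE; apply: eq_bigr => k _; rewrite !mxE.
Qed.

(** One witness suffices for [get]. With [K] a symmetric fourth root of [Q], [K *m K] is positive
    semidefinite because its quadratic form at [v] is [dot (K *m v) (K *m v)]. *)
Lemma sqrtmxP (R : realType) (m : nat) (Q : 'M[R]_m) :
  posdefmx Q -> possemidefmx (sqrtmx Q) /\ sqrtmx Q *m sqrtmx Q = Q.
Proof.
move=> [Qsym Qpos]; rewrite /sqrtmx; set S := [set P | _].
suff : exists P, S P by move=> /getPex.
rewrite {}/S /=; case: m => [|m] in Q Qsym Qpos *.
  exists 0; split; last by apply/matrixP => -[].
  by split=> [|v]; [apply/matrixP => -[]|rewrite /dot big_ord0].
have Qge0 r : eigenvalue Q r -> 0 <= r.
  move=> /eigenvalueP[v vQ v0]; have vT0 : v^T != 0.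
    by apply: contra_neq v0 => vT0; rewrite -[v]trmxK vT0 trmx0.
  have := Qpos _ vT0; rewrite -{1}Qsym -trmx_mul vQ linearZ dotZr => rv.
  have := dot_ge0 v^T; set d := dot _ _ in rv *; move=> d0.
  by rewrite leNgt; apply/negP => /ltW r0; rewrite ltNge mulr_le0_ge0 in rv.
have [p pQ] := symmetric_fourth_root Qsym Qge0; set K := horner_mx Q p in pQ.
have Ksym : K^T = K.
  rewrite /K; elim/poly_ind: p {pQ K} => [|p c IHp]; first by rewrite rmorph0 trmx0.
  rewrite rmorphD rmorphM /= horner_mx_X horner_mx_C linearD /= tr_scalar_mx.
  rewrite [(_ * _)^T]trmx_mul Qsym IHp; congr (_ + _).
  (* Transposition reverses the product; the two orders agree because [Q] commutes with polynomials
     in [Q]. *)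
  by have /(congr1 (horner_mx Q)) := mulrC 'X p; rewrite !rmorphM /= horner_mx_X.
exists (K *m K); split; first split.
- by rewrite trmx_mul Ksym.
- by move=> v; rewrite -mulmxA dot_mulmxr Ksym dot_ge0.
- by rewrite -[RHS]pQ (exprM K 2 2) !expr2.
Qed.

(** * Expansion and gradient of the quadratic *)

Section Quadratic.
Context {R : realType} {m : nat} (Q : 'M[R]_m) (b : 'cV[R]_m).
Hypothesis Qsym : Q^T = Q.
Local Notation f := (quadratic Q b).

Lemma quadraticD y v :
  f (y + v) = f y + dot v (Q *m y + b) + 2^-1 * dot v (Q *m v).
Proof.
rewrite /quadratic mulmxDr !dotDr !dotDl (dotC b v) [dot y (Q *m v)]dot_mulmxr.
by rewrite Qsym [dot _ v]dotC; field.
Qed.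

Lemma grad_quadratic y : grad f y = Q *m y + b.
Proof.
apply/colP => i; rewrite mxE -dot_delta; set e := delta_mx _ _.
apply: cvg_lim; first exact: Rhausdorff.
(* The difference quotient for [t != 0], extended continuously to 0. *)
pose q t := dot e (Q *m y + b) + t * (2^-1 * dot e (Q *m e)).
apply: (@cvg_trans _ (q @ 0^')).
  apply: near_eq_cvg; near=> t; rewrite /= /q [_ *: e + y]addrC quadraticD.
  rewrite -[Q *m (t *: e)]scalemxAr !dotZl dotZr.
  have t0 : t != 0 by near: t; exact: nbhs_dnbhs_neq.
  rewrite /GRing.scale /=; field.
  done.
have : q t @[t --> 0^'] --> dot e (Q *m y + b) + 0 * (2^-1 * dot e (Q *m e)).
  by apply: cvgD; [exact: cvg_cst|apply: cvgMl; exact: cvg_within].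
by rewrite mul0r addr0.
Unshelve. all: by end_near. Qed.

End Quadratic.

(** * Vertices and supports in the simplex *)

Section Simplex.
Context {R : realType} {n : nat}.
Implicit Types x u : 'cV[R]_n.

Lemma simplexP x : simplex x <-> nonneg x /\ \sum_i x i 0 = 1.
Proof.
by split=> -[x0 x1]; split=> //; rewrite -x1; apply: eq_bigr => i _;
  rewrite ger0_norm.
Qed.

Lemma in_supp x i : (i \in supp x) = (0 < x i 0).
Proof. by rewrite inE. Qed.

Lemma simplex_delta i : simplex (delta_mx i 0 : 'cV[R]_n).
Proof.
apply/simplexP; split=> [k|]; first by rewrite mxE ler0n.
rewrite (bigD1 i) //= !mxE !eqxx big1 ?addr0 // => k /negbTE ki.
by rewrite !mxE ki.
Qed.

Lemma simplex_eq_delta x i : simplex x -> x i 0 = 1 -> x = delta_mx i 0.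
Proof.
move=> /simplexP[x0 x1] xi; apply/colP => k; rewrite mxE eqxx andbT.
have [->//|ki] := eqVneq; apply/eqP; rewrite eq_le x0 andbT.
rewrite -(lerD2l (x i 0)) addr0 [leRHS]xi -x1 (bigD1 i) //= lerD2l.
by rewrite (bigD1 k) //= lerDl sumr_ge0.
Qed.

Lemma simplex_le1 x i : simplex x -> x i 0 <= 1.
Proof.
by move=> /simplexP[x0 <-]; rewrite (bigD1 i) //= lerDl sumr_ge0.
Qed.

Lemma simplex_supp_neq0 x : simplex x -> (0 < #|supp x|)%N.
Proof.
move=> /simplexP[x0 x1]; rewrite lt0n; apply: contra_eq_neq x1.
move=> /eqP; rewrite cards_eq0 => /eqP xs; rewrite big1 1?eq_sym ?oner_neq0 //.
move=> i _; apply/eqP; rewrite eq_le x0 andbT leNgt -in_supp xs.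
by rewrite finset.in_set0.
Qed.

(** If [0 < x i 0 < 1], then [x] is a proper convex combination of the vertex [i] and the
    renormalized rest [v], so extremality makes [x] that vertex. *)
Lemma extreme_point_simplex x :
  extreme_point (@simplex R n) x -> exists i, x = delta_mx i 0.
Proof.
move=> [xS xext]; have /card_gt0P := simplex_supp_neq0 xS.
case=> i; rewrite in_supp => xi; exists i.
have [|xi1] := eqVneq (x i 0) 1; first exact: simplex_eq_delta.
have {}xi1 : 0 < 1 - x i 0 by rewrite subr_gt0 lt_neqAle xi1 simplex_le1.
pose v := (1 - x i 0)^-1 *: (x - x i 0 *: delta_mx i 0).
suff vS : simplex v.
  have xi01 : 0 < x i 0 < 1 by rewrite xi -[_ < 1]subr_gt0.
  have [//|-> //] := xext _ _ _ (simplex_delta i) vS xi01.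
  by rewrite scalerA mulfV ?(gt_eqF xi1) // scale1r addrC subrK.
have /simplexP[x0 x1] := xS; have /simplexP[_ d1] := simplex_delta i.
apply/simplexP; split=> [k|].
  rewrite !mxE eqxx andbT mulr_ge0 ?invr_ge0 ?(ltW xi1) //.
  by have [->|] := eqVneq; rewrite /= ?mulr1 ?subrr ?mulr0 ?subr0.
have vE k : v k 0 = (1 - x i 0)^-1 * (x k 0 - x i 0 * (delta_mx i 0 : 'cV_n) k 0).
  by rewrite !mxE.
rewrite (eq_bigr _ (fun k _ => vE k)).
by rewrite -mulr_sumr sumrB -mulr_sumr x1 d1 mulr1 mulVf ?gt_eqF.
Qed.

Lemma supp_delta i : supp (delta_mx i 0 : 'cV[R]_n) = [set i]%SET.
Proof.
by apply/setP => k; rewrite in_supp finset.in_set1 mxE eqxx andbT ltr0n lt0b.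
Qed.

Lemma simplex_dot_ge m (A : 'M[R]_(m, n)) g c u : simplex u ->
  (forall i, c <= dot (col i A) g) -> c <= dot (A *m u) g.
Proof.
move=> /simplexP[u0 u1] cg; rewrite dot_mulmxl -[c]mul1r -u1 mulr_suml.
by apply: ler_sum => i _; rewrite ler_wpM2l.
Qed.

Lemma simplex_dot_le m (A : 'M[R]_(m, n)) g c u : simplex u ->
  (forall i, i \in supp u -> dot (col i A) g <= c) -> dot (A *m u) g <= c.
Proof.
move=> /simplexP[u0 u1] cg; rewrite dot_mulmxl -[c]mul1r -u1 mulr_suml.
apply: ler_sum => i _; have := u0 i; rewrite le_eqVlt => /predU1P[<-|ui].
  by rewrite !mul0r.
by rewrite ler_wpM2l // cg // in_supp.
Qed.

End Simplex.

(** * Restricted width and diameter *)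

Section Width.
Context {R : realType} {m n : nat} (M : 'M[R]_(m, n)).

(** The entries of [x - u] lie in [[-1, 1]], so each entry of the image is at most the absolute sum
    of its row of [M]. *)
Lemma diam_has_ubound : has_ubound [set r : R | exists x u : 'cV[R]_n,
  [/\ simplex x, simplex u & r = enorm (M *m x - M *m u)]].
Proof.
exists (Num.sqrt (\sum_i (\sum_j `|M i j|) ^+ 2)) => _ [x [u [xS uS ->]]].
rewrite ler_sqrt; last by apply: sumr_ge0 => i _; rewrite sqr_ge0.
apply: ler_sum => i _; rewrite -expr2 -mulmxBr mxE -real_normK ?num_real //.
rewrite lerXn2r ?nnegrE ?sumr_ge0 //; apply: le_trans (ler_norm_sum _ _ _) _.
apply: ler_sum => j _; rewrite normrM ler_piMr // !mxE.
have /simplexP[x0 _] := xS; have /simplexP[u0 _] := uS.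
have := simplex_le1 j xS; have := simplex_le1 j uS.
by have := x0 j; have := u0 j; rewrite ler_norml; lra.
Qed.

Lemma le_diam x u : simplex x -> simplex u -> enorm (M *m x - M *m u) <= diam M.
Proof. by move=> xS uS; apply: ub_le_sup diam_has_ubound _ _; exists x, u. Qed.

Lemma diam_ge0 : 0 <= diam M.
Proof.
rewrite /diam; set S := [set r | _].
have [->|/set0P[r Sr]] := eqVneq S set0; first by rewrite sup0.
have [x [u [_ _ re]]] := Sr; apply: (@le_trans _ _ r).
  by rewrite re enorm_ge0.
exact: ub_le_sup diam_has_ubound _ _.
Qed.

Lemma rwidth_at_le x c : 0 <= c ->
  (forall lam u v, 0 < lam -> simplex u -> simplex v -> supp u \subset supp x ->
    M *m u - M *m v = (lam / enorm (M *m x)) *: (M *m x) -> lam <= c) ->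
  rwidth_at M x <= c.
Proof.
move=> c0 ub; rewrite /rwidth_at; set S := [set r | _].
(* The empty set has [sup] 0, hence the assumption [0 <= c]. *)
have [->|/set0P S0] := eqVneq S set0; first by rewrite sup0.
by apply: ge_sup => // lam [lam0 [u [v [uS vS uv]]]]; exact: ub.
Qed.

Lemma rwidth_at_ge0 x : 0 <= rwidth_at M x.
Proof.
rewrite /rwidth_at; set S := [set r | _].
have [[[r Sr] Sub]|Sout] := pselect (has_sup S); last by rewrite sup_out.
by apply: (@le_trans _ _ r); [have [/ltW] := Sr|exact: ub_le_sup].
Qed.

(** The direction is normalized, so an admissible [lam] is the distance from [M *m u] to
    [M *m v]. *)
Lemma rwidth_at_le_diam x : M *m x != 0 -> rwidth_at M x <= diam M.
Proof.
move=> Mx0; apply: rwidth_at_le diam_ge0 _ => lam u v lam0 uS vS _ uv.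
suff <- : enorm (M *m u - M *m v) = lam by exact: le_diam.
have Mx : 0 < enorm (M *m x).
  by rewrite lt_neqAle enorm_ge0 andbT eq_sym; apply: contra_neq Mx0 => /enorm0_eq0.
by rewrite uv enormZ gtr0_norm ?divr_gt0 // divfK ?gt_eqF.
Qed.

Lemma rwidth_le x : nonneg x -> M *m x != 0 -> rwidth M <= rwidth_at M x.
Proof.
move=> x0 Mx0; apply: ge_inf; last by exists x.
by exists 0 => _ [u [_ _ ->]]; exact: rwidth_at_ge0.
Qed.

Lemma rwidth_ge0 : 0 <= rwidth M.
Proof.
rewrite /rwidth; set S := [set r | _].
have [->|/set0P S0] := eqVneq S set0; first by rewrite inf0.
by apply: lb_le_inf => // _ [u [_ _ ->]]; exact: rwidth_at_ge0.
Qed.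

Lemma rwidth_le_diam : rwidth M <= diam M.
Proof.
have [[x [x0 Mx]]|noM] := pselect (exists x : 'cV[R]_n, nonneg x /\ M *m x != 0).
  exact: le_trans (rwidth_le x0 Mx) (rwidth_at_le_diam Mx).
rewrite /rwidth (_ : [set r | _] = set0) ?inf0 ?diam_ge0 //.
by apply/seteqP; split=> // r [x [x0 Mx _]]; case: noM; exists x.
Qed.

(** This keeps the rate positive and lets any step that halves the excess count as good. *)
Lemma rate_ge34 : 3 / 4 <= 1 - rwidth M ^+ 2 / (4 * diam M ^+ 2).
Proof.
have [->|d0] := eqVneq (diam M) 0.
  by rewrite expr0n mulr0 invr0 mulr0 subr0; lra.
have d2 : 0 < 4 * diam M ^+ 2 by rewrite mulr_gt0 // exprn_even_gt0.
suff : rwidth M ^+ 2 / (4 * diam M ^+ 2) <= 1 / 4 by lra.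
rewrite ler_pdivrMr // mulrA mulfVK // ?mul1r.
by rewrite lerXn2r ?nnegrE ?rwidth_ge0 ?diam_ge0 ?rwidth_le_diam.
Qed.

End Width.

(** Here [p] will be the smaller of two slopes with sum [- G]. *)
Lemma le_double_opp (R : realDomainType) (p G : R) :
  0 <= G -> p + p <= - G -> p <= 0 /\ G ^+ 2 <= (2 * p) ^+ 2.
Proof.
move=> G0 pG; split; first by lra.
by rewrite -[leRHS]sqrrN lerXn2r ?nnegrE; lra.
Qed.

(** * Exact line search on a one-variable quadratic *)

Section LineSearch.
Context {R : realFieldType} (p c D T t : R).
Local Notation q s := (s * p + 2^-1 * (s * (s * c))).
Hypotheses (p_le0 : p <= 0) (c_ge0 : 0 <= c) (cD : c <= D) (D_gt0 : 0 < D).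
Hypothesis t_ge0 : 0 <= t.
Hypothesis qt_min : forall s, 0 <= s <= T -> q t <= q s.

(** The size [- p / D] is optimal for curvature [D]; the true curvature [c <= D] gives a value at
    most as large there. *)
Lemma line_search_newton : - p / D <= T -> q t <= - (p ^+ 2 / (2 * D)).
Proof.
move=> pT; have s0 : 0 <= - p / D by rewrite divr_ge0 ?oppr_ge0 // ltW.
have /qt_min/le_trans-> // : 0 <= - p / D <= T by rewrite s0.
have -> : - (p ^+ 2 / (2 * D)) = q (- p / D) + 2^-1 * (- p / D) ^+ 2 * (D - c).
  by field; rewrite gt_eqF.
by rewrite lerDl mulr_ge0 ?subr_ge0 // mulr_ge0 ?sqr_ge0 ?invr_ge0.
Qed.

(** If [- p / D] exceeded [T], then [q] would have a negative chord slope from [t] to [T], and [T]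
    would beat the minimizer [t]. *)
Lemma line_search_interior : t < T -> q t <= - (p ^+ 2 / (2 * D)).
Proof.
move=> ltT; apply: line_search_newton; rewrite ler_pdivrMr // leNgt.
apply/negP => TD; have T0 : 0 < T by exact: le_lt_trans ltT.
have := qt_min (s := T); rewrite lexx ltW // => /(_ isT).
have cT : c * T < - p by apply: le_lt_trans TD; rewrite mulrC ler_pM2l.
have ct : c * t < - p by apply: le_lt_trans cT; rewrite ler_wpM2l // ltW.
have -> : q T = q t + (T - t) * (p + 2^-1 * (c * T + c * t)) by field.
by rewrite leNgt gtrDl pmulr_rlt0 ?subr_gt0 //; lra.
Qed.

End LineSearch.

(** * Decrease per step and linear rate *)

Section Convergence.
Context {R : realType} {m n : nat} (A : 'M[R]_(m, n)) (Q : 'M[R]_m)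
  (b : 'cV[R]_m) (xstar : 'cV[R]_n).
Hypothesis Qpos : posdefmx Q.
Local Notation f := (quadratic Q b).
Hypothesis xstar_min : is_argmin (@simplex R n) (fun z => f (A *m z)) xstar.
Local Notation ystar := (A *m xstar).
Local Notation Abar :=
  (sqrtmx Q *m (\matrix_(i < m, j < n) (A i j - ystar i 0))).
Local Notation excess y := (f y - f ystar).
Local Notation rate := (1 - rwidth Abar ^+ 2 / (4 * diam Abar ^+ 2)).
Implicit Types (x u : 'cV[R]_n) (y v g : 'cV[R]_m).

(** Through this, [diam Abar ^+ 2] bounds the curvature of [f] along differences of feasible
    points. *)
Lemma enorm_sqrtmx v : enorm (sqrtmx Q *m v) ^+ 2 = dot v (Q *m v).
Proof.
have [[Psym _] {2}<-] := sqrtmxP Qpos.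
by rewrite enorm_sqr -mulmxA [RHS]dot_mulmxr Psym.
Qed.

Lemma sqrtmx_eq0 v : sqrtmx Q *m v = 0 -> v = 0.
Proof.
move=> Pv0; apply: contra_eq (erefl (0 : R)) => v0.
have [_ /(_ _ v0)] := Qpos.
by rewrite -enorm_sqrtmx Pv0 enorm_sqr /dot big1 ?ltxx // => i _; rewrite mxE mul0r.
Qed.

Lemma mulmx_Abar u : simplex u -> Abar *m u = sqrtmx Q *m (A *m u - ystar).
Proof.
move=> /simplexP[_ u1]; rewrite -mulmxA; congr (_ *m _); apply/colP => i.
rewrite [RHS]mxE mxE [(- ystar) i 0]mxE [(A *m u) i 0]mxE.
rewrite -[ystar i 0]mulr1 -u1 mulr_sumr -sumrB; apply: eq_bigr => k _.
by rewrite mxE mulrBl.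
Qed.

Lemma mulmx_AbarB u x : simplex u -> simplex x ->
  Abar *m u - Abar *m x = sqrtmx Q *m (A *m u - A *m x).
Proof.
by move=> uS xS; rewrite !mulmx_Abar // -mulmxBr opprB addrA subrK.
Qed.

Lemma excess_ge0 x : simplex x -> 0 <= excess (A *m x).
Proof. by move=> xS; rewrite subr_ge0; apply: xstar_min.2. Qed.

Lemma excess_grad y :
  dot (y - ystar) (Q *m y + b) =
  excess y + 2^-1 * enorm (sqrtmx Q *m (y - ystar)) ^+ 2.
Proof.
have := quadraticD b Qpos.1 y (- (y - ystar)).
rewrite subKr => ->; rewrite enorm_sqrtmx dotNl mulmxN dotNl.
by rewrite [dot _ (- _)]dotC dotNl [dot (Q *m _) _]dotC; field.
Qed.

Lemma excess_le_grad x : simplex x ->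
  excess (A *m x) <= dot (A *m x - ystar) (Q *m (A *m x) + b).
Proof.
by move=> xS; rewrite excess_grad lerDl mulr_ge0 ?invr_ge0 ?sqr_ge0.
Qed.

(** For admissible [lam], [u], [v], the vector [A *m u - A *m v] is a multiple of [A *m x - ystar].
    Its pairing with [g] is at least [lam * Num.sqrt (2 * h)], and at most [G]: [l] bounds the [u]
    part because [supp u] lies in [supp x], and [j] bounds the [v] part. *)
Lemma rwidth_excess_le x j l : simplex x ->
  let g := Q *m (A *m x) + b in
  is_argmin [set: 'I_n] (fun i => dot (col i A) g) j ->
  is_argmax [set i | i \in supp x] (fun i => dot (col i A) g) l ->
  rwidth Abar ^+ 2 * (2 * excess (A *m x)) <=
    (dot (col l A) g - dot (col j A) g) ^+ 2.
Proof.
move=> xS g jmin lmax; set h := excess _; set G := _ - _.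
have vj (v : 'cV_n) : simplex v -> dot (col j A) g <= dot (A *m v) g.
  by move=> vS; apply: simplex_dot_ge => // i; apply: jmin.2.
have ul u : simplex u -> supp u \subset supp x ->
    dot (A *m u) g <= dot (col l A) g.
  move=> uS /fintype.subsetP ux; apply: simplex_dot_le => // i /ux; exact: lmax.2.
have := excess_ge0 xS; rewrite -/h le_eqVlt => /predU1P[<-|h0].
  by rewrite !mulr0 sqr_ge0.
have G0 : 0 <= G by rewrite subr_ge0; apply: le_trans (vj _ xS) (ul _ xS _).
have z0 : Abar *m x != 0.
  rewrite mulmx_Abar //; apply: contraTneq h0 => /sqrtmx_eq0/eqP.
  by rewrite subr_eq0 /h => /eqP->; rewrite subrr ltxx.
have nz0 : 0 < enorm (Abar *m x).
  by rewrite lt_neqAle enorm_ge0 andbT eq_sym; apply: contra_neq z0 => /enorm0_eq0.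
have s0 : 0 < Num.sqrt (2 * h) by rewrite sqrtr_gt0 mulr_gt0.
suff : rwidth Abar <= G / Num.sqrt (2 * h).
  rewrite ler_pdivlMr // => wG.
  rewrite -[2 * h]sqr_sqrtr ?mulr_ge0 ?(ltW h0) // -exprMn.
  by rewrite lerXn2r // nnegrE mulr_ge0 ?rwidth_ge0 ?(ltW s0).
have x0 : nonneg x by have /simplexP[] := xS.
apply: le_trans (rwidth_le x0 z0) _.
apply: rwidth_at_le => [|lam u v lam0 uS vS ux uv]; first by rewrite divr_ge0 // ltW.
rewrite ler_pdivlMr //; apply: (@le_trans _ _ (dot (A *m u - A *m v) g)); last first.
  by rewrite dotBl lerB ?vj ?ul.
have -> : A *m u - A *m v = (lam / enorm (Abar *m x)) *: (A *m x - ystar).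
  apply/eqP; rewrite -subr_eq0; apply/eqP/sqrtmx_eq0.
  rewrite mulmxBr -mulmx_AbarB // uv mulmx_Abar //.
  by rewrite -scalemxAr subrr.
rewrite dotZl -mulrA ler_pM2l // [leRHS]mulrC ler_pdivlMr //.
rewrite excess_grad -/h -mulmx_Abar //.
(* Writing [h] as half a square reduces the claim to [0 <= (c - d) ^+ 2]. *)
rewrite -[X in X + _](_ : 2^-1 * Num.sqrt (2 * h) ^+ 2 = _); last first.
  by rewrite sqr_sqrtr ?mulr_ge0 ?(ltW h0) // mulKf.
move: (Num.sqrt _) (enorm _) => c d; have := sqr_ge0 (c - d); rewrite sqrrB; lra.
Qed.

Lemma mulmx_delta j : A *m delta_mx j 0 = col j A.
Proof. by rewrite colE. Qed.

Lemma quadratic_line y v (t : R) : f (y + t *: v) =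
  f y + (t * dot v (Q *m y + b) + 2^-1 * (t * (t * dot v (Q *m v)))).
Proof. by rewrite quadraticD ?Qpos.1 // -scalemxAr !dotZl dotZr addrA. Qed.

Lemma simplex_toward x x' (j : 'I_n) (t : R) : simplex x -> 0 <= t <= 1 ->
  x' = x + t *: (delta_mx j 0 - x) ->
  simplex x' /\ (#|supp x'| <= #|supp x|.+1)%N.
Proof.
move=> xS /andP[t0 t1] ->; have /simplexP[x0 x1] := xS.
have /simplexP[d0 d1] : simplex (delta_mx j 0 : 'cV[R]_n) := simplex_delta j.
have uE i : (x + t *: (delta_mx j 0 - x)) i 0 =
    (1 - t) * x i 0 + t * (delta_mx j 0 : 'cV_n) i 0.
  by rewrite !mxE; ring.
split.
  apply/simplexP; split=> [i|].
    by rewrite uE addr_ge0 // mulr_ge0 // subr_ge0.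
  rewrite (eq_bigr _ (fun i _ => uE i)) big_split /= -!mulr_sumr x1 d1.
  by rewrite !mulr1 subrK.
apply: (@leq_trans #|(j |: supp x)%SET|); last by rewrite cardsU1; case: (_ \notin _).
apply/subset_leq_card/fintype.subsetP => i.
rewrite in_setU1 !in_supp uE !mxE eqxx andbT.
have [//|_ /=] := eqVneq i j; rewrite mulr0 addr0 => xi.
by rewrite lt_neqAle x0 andbT; apply: contraTneq xi => <-; rewrite mulr0 ltxx.
Qed.

(** Weights other than that of [l] scale by [1 + t]; the weight of [l] decreases and vanishes
    exactly at the maximal size. *)
Lemma simplex_away x x' (l : 'I_n) (t : R) : simplex x -> x l 0 < 1 ->
    0 <= t <= x l 0 / (1 - x l 0) -> x' = x + t *: (x - delta_mx l 0) ->
  [/\ simplex x', supp x' \subset supp x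
    & t = x l 0 / (1 - x l 0) -> l \notin supp x'].
Proof.
move=> xS xl1 /andP[t0 tT] ->; have /simplexP[x0 x1] := xS.
have /simplexP[d0 d1] : simplex (delta_mx l 0 : 'cV[R]_n) := simplex_delta l.
have uE i : (x + t *: (x - delta_mx l 0)) i 0 =
    (1 + t) * x i 0 - t * (delta_mx l 0 : 'cV_n) i 0.
  by rewrite !mxE; ring.
have xl1' : 0 < 1 - x l 0 by rewrite subr_gt0.
have dE i : (delta_mx l 0 : 'cV[R]_n) i 0 = (i == l)%:R by rewrite mxE eqxx andbT.
split.
- apply/simplexP; split=> [i|].
    rewrite uE dE; have [->|_] := eqVneq; rewrite /= ?mulr0 ?subr0 ?mulr1.
      by move: tT; rewrite ler_pdivlMr //; lra.
    by rewrite mulr_ge0 // addr_ge0.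
  rewrite (eq_bigr _ (fun i _ => uE i)) sumrB -!mulr_sumr x1 d1.
  by rewrite !mulr1 addrK.
- apply/fintype.subsetP => i; rewrite !in_supp uE dE => xi.
  rewrite lt_neqAle x0 andbT; apply: contraTneq xi => <-.
  by rewrite mulr0 sub0r oppr_gt0 -leNgt mulr_ge0.
- move=> tE; rewrite in_supp uE dE eqxx mulr1 -leNgt tE.
  suff -> : (1 + x l 0 / (1 - x l 0)) * x l 0 - x l 0 / (1 - x l 0) = 0 by [].
  by field; rewrite gt_eqF.
Qed.

(** The decrease [p ^+ 2 / (2 * D)] is [(2 * p) ^+ 2 / (8 * D)], at least the fraction
    [rwidth Abar ^+ 2 / (4 * D)] of the excess. *)
Lemma newton_rate x a (t : R) (D := diam Abar ^+ 2) (p := dot a (Q *m (A *m x) + b)) :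
  rwidth Abar ^+ 2 * (2 * excess (A *m x)) <= (2 * p) ^+ 2 ->
  excess (A *m x + t *: a) <= excess (A *m x) ->
  (0 < D -> f (A *m x + t *: a) <= f (A *m x) - p ^+ 2 / (2 * D)) ->
  excess (A *m x + t *: a) <= rate * excess (A *m x).
Proof.
move=> wp le0 le1; have : 0 <= D by exact: sqr_ge0.
(* For [D = 0], division by zero makes [rate] equal to 1, and monotonicity suffices. *)
rewrite le_eqVlt => /predU1P[D0|D0].
  by rewrite -/D -D0 mulr0 invr0 mulr0 subr0 mul1r.
rewrite lerBlDr (le_trans (le1 D0)) //.
rewrite -/D; set h := excess _ in wp *; set w := rwidth _ in wp *.
have -> : (1 - w ^+ 2 / (4 * D)) * h + f ystar =
   f (A *m x) - (w ^+ 2 * (2 * h)) / (8 * D).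
  by rewrite /h; field; rewrite gt_eqF.
have -> : p ^+ 2 / (2 * D) = (2 * p) ^+ 2 / (8 * D) by field; rewrite gt_eqF.
by rewrite lerD2l lerN2 ler_wpM2r // invr_ge0 mulr_ge0 // ltW.
Qed.

Lemma afw_step_descent x x' y' : simplex x -> afw_step f A x (A *m x) x' y' ->
  simplex x' /\
  (excess (A *m x') <= rate * excess (A *m x) /\ (#|supp x'| <= #|supp x|.+1)%N \/
   excess (A *m x') <= excess (A *m x) /\ (#|supp x'| < #|supp x|)%N).
Proof.
move=> xS [j [l [t]]]; rewrite (grad_quadratic b Qpos.1) /=.
set g := Q *m (A *m x) + b; set y := A *m x.
set p1 := dot (col j A - y) g; set p2 := dot (y - col l A) g.
move=> [jmin lmax tmin x'E _].
have G0 : 0 <= dot (col l A) g - dot (col j A) g by rewrite subr_ge0; exact: jmin.2.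
have p12 : p1 + p2 = - (dot (col l A) g - dot (col j A) g).
  by rewrite /p1 /p2 !dotBl; ring.
have wG := rwidth_excess_le xS jmin lmax.
have wp p : p + p <= p1 + p2 -> p <= 0 /\
    rwidth Abar ^+ 2 * (2 * excess y) <= (2 * p) ^+ 2.
  rewrite p12 => /(le_double_opp G0)[p0 Gp]; split=> //.
  exact: le_trans wG Gp.
have cD (u v : 'cV_n) : simplex u -> simplex v ->
    dot (A *m u - A *m v) (Q *m (A *m u - A *m v)) <= diam Abar ^+ 2.
  move=> uS vS; rewrite -enorm_sqrtmx -mulmx_AbarB //.
  by rewrite lerXn2r ?nnegrE ?enorm_ge0 ?diam_ge0 ?le_diam.
have c_ge0 v : 0 <= dot v (Q *m v) by rewrite -enorm_sqrtmx sqr_ge0.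
(* By convexity the excess is at most the descent slope towards [ystar], and [j] is at least as
   steep. *)
have hp1 : excess y <= - p1.
  apply: le_trans (excess_le_grad xS) _; rewrite -/g -/y /p1 -dotNl opprB !dotBl.
  by rewrite lerD2l lerN2; apply: simplex_dot_ge xstar_min.1 _ => i; exact: jmin.2.
have step v s : f (y + s *: v) =
    f y + (s * dot v g + 2^-1 * (s * (s * dot v (Q *m v)))).
  exact: quadratic_line.
have f0 v : f y = f (y + 0 *: v) by rewrite scale0r addr0.
case: ifPn tmin x'E => [reg|nreg] [/=]; rewrite in_itv /= => /andP[t0 tT] tmin x'E.
  have t01 : 0 <= t <= 1 by rewrite t0.
  have [x'S x'supp] := simplex_toward xS t01 x'E.
  split=> //; left; split=> //.
  have -> : A *m x' = y + t *: (col j A - y).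
    by rewrite x'E mulmxDr -scalemxAr mulmxBr mulmx_delta.
  clear x'E.
  have [p0 wp1] := wp p1 (lerD (lexx _) (ltW reg)).
  have fle s : 0 <= s <= 1 -> f (y + t *: (col j A - y)) <= f (y + s *: (col j A - y)).
    by move=> s01; apply: tmin; rewrite /= in_itv.
  have := cD _ _ (simplex_delta j) xS; rewrite mulmx_delta -/y.
  have := c_ge0 (col j A - y).
  set c := dot _ (Q *m _) => c0 cleD.
  have qt s : 0 <= s <= 1 ->
      t * p1 + 2^-1 * (t * (t * c)) <= s * p1 + 2^-1 * (s * (s * c)).
    by move=> /fle; rewrite !step lerD2l.
  (* Either the size [- p1 / D], with [D = diam Abar ^+ 2], is at most 1, or size 1 already gains
     [- p1 / 2], at least half the excess. *)
  have [p1D|Dp1] := leP (- p1) (diam Abar ^+ 2).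
    apply: newton_rate => //.
      by rewrite lerD2r [leRHS](f0 (col j A - y)) fle // lexx ler01.
    move=> D0; rewrite step lerD2l; apply: (line_search_newton p0 cleD D0 qt).
    by rewrite ler_pdivrMr // mul1r.
  apply: (@le_trans _ _ (excess y + 2^-1 * p1)).
    rewrite step addrAC lerD2l.
    have /qt/le_trans : 0 <= (1 : R) <= 1 by rewrite ler01 lexx.
    apply; move: (le_lt_trans cleD Dp1); rewrite !mul1r; lra.
  have := rate_ge34 Abar; have := excess_ge0 xS; rewrite -/y.
  move: (excess y) (rate) hp1 => h r hp h0 r34.
  have : 3 / 4 * h <= r * h by rewrite ler_wpM2r.
  lra.
have {}nreg : p2 <= p1 by rewrite leNgt.
have [p0 wp2] := wp p2 (lerD nreg (lexx _)).
(* If [x] is the vertex [l], then [p2 = 0] and so [p1 >= 0]: the excess is 0 and the null step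
   counts as good. *)
have := simplex_le1 l xS; rewrite le_eqVlt => /predU1P[xl1|xl1].
  have xE := simplex_eq_delta xS xl1.
  have x'x : x' = x by rewrite x'E {2}xE subrr scaler0 addr0.
  have h0 : excess y = 0.
    apply/eqP; rewrite eq_le (excess_ge0 xS) andbT (le_trans hp1) // oppr_le0.
    by apply: le_trans nreg; rewrite /p2 /y xE mulmx_delta subrr dotC /dot
      big1 // => i _; rewrite [X in _ * X]mxE mulr0.
  by split; [rewrite x'x|left; rewrite x'x -/y h0 mulr0 lexx leqnSn].
have t0T : 0 <= t <= x l 0 / (1 - x l 0) by rewrite t0.
have [x'S x'x x'l] := simplex_away xS xl1 t0T x'E; split=> //.
have -> : A *m x' = y + t *: (y - col l A).
  by rewrite x'E mulmxDr -scalemxAr mulmxBr mulmx_delta.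
have fle s : 0 <= s <= x l 0 / (1 - x l 0) ->
    f (y + t *: (y - col l A)) <= f (y + s *: (y - col l A)).
  by move=> s01; apply: tmin; rewrite /= in_itv.
have le0 : excess (y + t *: (y - col l A)) <= excess y.
  rewrite lerD2r [leRHS](f0 (y - col l A)) fle // lexx /=; exact: le_trans tT.
(* A maximal away step drops [l]; a shorter one is an interior minimizer. *)
move: tT; rewrite le_eqVlt => /predU1P[/x'l l'|tT].
  right; split=> //; apply: proper_card; apply/properP; split=> //.
  by exists l => //; exact: lmax.1.
left; split; last by apply: leqW; exact: subset_leq_card.
apply: newton_rate => // D0; rewrite step lerD2l.
apply: (line_search_interior p0 (c_ge0 _) _ D0 t0 _ tT).
  by rewrite -mulmx_delta; exact: cD xS (simplex_delta l).
by move=> s /fle; rewrite !step lerD2l.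
Qed.

(* [d] counts the steps that multiply the excess by [rate]. *)
Lemma afw_rate (x : nat -> 'cV[R]_n) (y : nat -> 'cV[R]_m) k :
  extreme_point (@simplex R n) (x 0%N) -> afw_iterates f A x y ->
  [/\ simplex (x k), y k = A *m x k & exists2 d : nat,
    (k + #|supp (x k)| <= 2 * d + 1)%N & excess (y k) <= rate ^+ d * excess (y 0%N)].
Proof.
move=> x0ext [x0S y0E xyS].
have rate0 : 0 <= rate by apply: le_trans (rate_ge34 Abar).
elim: k => [|k [xkS ykE [d kd hd]]].
  (* The bound [0 + 1 <= 1] is where starting at a vertex matters. *)
  split=> //; exists 0; last by rewrite expr0 mul1r.
  by have [i ->] := extreme_point_simplex x0ext; rewrite supp_delta cards1.
have y'E : y k.+1 = A *m x k.+1 by have [? [? [? []]]] := xyS k.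
have := xyS k; rewrite ykE => /(afw_step_descent xkS)[x'S good_or_drop].
split=> //; move: good_or_drop; rewrite -ykE -y'E.
(* A good step raises [k + #|supp (x k)|] by at most 2, paid for by [d.+1]; a drop step does not
   raise it. *)
case=> -[h' supp']; [exists d.+1|exists d] => //.
- lia.
- by apply: le_trans h' _; rewrite [_ ^+ d.+1]exprS -mulrA ler_wpM2l.
- lia.
- exact: le_trans h' hd.
Qed.

Lemma afw_linear_rate (x : nat -> 'cV[R]_n) (y : nat -> 'cV[R]_m) k :
  extreme_point (@simplex R n) (x 0%N) -> afw_iterates f A x y ->
  excess (y k) <= rate `^ (k%:R / 2) * excess (y 0%N).
Proof.
move=> x0ext xyit; have [xkS _ [d kd]] := afw_rate k x0ext xyit.
have [x0S -> _] := xyit; move=> /le_trans; apply.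
apply: ler_wpM2r; first exact: excess_ge0.
have r34 := rate_ge34 Abar; have r0 : 0 < rate by apply: lt_le_trans r34.
have r1 : rate <= 1.
  by rewrite gerBl divr_ge0 ?sqr_ge0 // mulr_ge0 ?sqr_ge0.
(* A nonempty support turns the count into [k <= 2 * d]; as [rate] is in []0, 1]], the exponent [d]
   may be lowered to [k / 2]. *)
have k1 := simplex_supp_neq0 xkS.
rewrite -[_ ^+ d]powR_mulrn ?(ltW r0) //; apply: ger_powR; first by rewrite r0.
by rewrite ler_pdivrMr // -natrM ler_nat; lia.
Qed.

End Convergence.

Theorem theorem2 (R : realType) (m n : nat) (A : 'M[R]_(m, n)) (Q : 'M[R]_m)
    (b : 'cV[R]_m) (xstar : 'cV[R]_n)
    (x : nat -> 'cV[R]_n) (y : nat -> 'cV[R]_m) :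
  A != 0 ->
  posdefmx Q ->
  let f := quadratic Q b in
  is_argmin (@simplex R n) (fun z => f (A *m z)) xstar ->
  let ystar := A *m xstar in
  let Abar := sqrtmx Q *m (\matrix_(i < m, j < n) (A i j - ystar i 0)) in
  extreme_point (@simplex R n) (x 0%N) ->
  afw_iterates f A x y ->
  forall k : nat, (1 <= k)%N ->
    f (y k) - f ystar <=
      (1 - rwidth Abar ^+ 2 / (4 * diam Abar ^+ 2)) `^ (k%:R / 2)
        * (f (y 0%N) - f ystar).
Proof.
move=> _ Qpos f xstar_min ystar Abar x0ext xyit k _.
exact: (afw_linear_rate Qpos xstar_min k x0ext xyit).
Qed.
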